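(* Assume $\ell(w,z)\in[0,1]$ for all $w,z$. Define $\bar L^+_i=\ell(W,\widetilde{Z}^{i,0}_{1,\overline{U}^{i,0}_1})$, $\bar L^-_i=\ell(W,\widetilde{Z}^{i,1}_{1,\overline{U}^{i,1}_1})$, $\Delta\bar L_i=\bar L^-_i-\bar L^+_i$, and $L^{i+}_j=\ell(W,\widetilde{Z}^{i,V_i}_{j,0})$, $L^{i-}_j=\ell(W,\widetilde{Z}^{i,V_i}_{j,1})$, $\Delta L^i_j=L^{i-}_j-L^{i+}_j$. Then $$|\mathcal{E}_{\mathcal{D}}(\mathcal{A})|\le\frac1K\sum_{i=1}^K\sqrt{2I(\Delta\bar L_i;V_i)}+\frac{1}{Kn}\sum_{i=1}^K\sum_{j=1}^n\mathbb{E}_{V_i}\sqrt{2I^{V_i}(\Delta L^i_j;U^{i,V_i}_j)}.$$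
   Context: Setting. $\mathcal{Z}$ is an instance space, $\mathcal{W}$ a hypothesis space, $\mathcal{C}$ a set of clients; each client $c\in\mathcal{C}$ has a data distribution $\mu_c$ on $\mathcal{Z}$, and $\mathcal{D}$ is a probability distribution on $\mathcal{C}$ (so a draw from $\mathcal{D}$ yields a data distribution on $\mathcal{Z}$). A loss $\ell:\mathcal{W}\times\mathcal{Z}\to[0,\infty)$ is given. There are $K$ participating clients, each with $n$ training points. A federated learning (FL) algorithm $\mathcal{A}$ is a conditional distribution $P_{W|S}$ mapping the collective training sample $S=(S_1,\dots,S_K)\in\mathcal{Z}^{nK}$ to a hypothesis $W\in\mathcal{W}$. Superclient/supersample construction. Let $\tilde\mu=(\tilde\mu_{i,b})_{i\in[K],b\in\{0,1\}}$ have i.i.d. entries drawn from $\mathcal{D}$. Conditionally on $\tilde\mu$, for each $(i,b)$ let $\widetilde{Z}^{i,b}=(\widetilde{Z}^{i,b}_{j,c})_{j\in[n],c\in\{0,1\}}$ have i.i.d. entries drawn from $\tilde\mu_{i,b}$, independently over $(i,b)$. Let $V=(V_1,\dots,V_K)$ and $U^{i,b}=(U^{i,b}_j)_{j\in[n]}$ ($i\in[K]$, $b\in\{0,1\}$) be mutually independent $\mathrm{Unif}\{0,1\}$ random variables, independent of $(\tilde\mu,\widetilde{Z})$. Write $\overline{V}_i=1-V_i$, $\overline{U}^{i,b}_j=1-U^{i,b}_j$. The $i$-th participating client distribution is $\mu_i=\tilde\mu_{i,V_i}$ and its training set is $S_i=(Z_{i,1},\dots,Z_{i,n})$ with $Z_{i,j}=\widetilde{Z}^{i,V_i}_{j,U^{i,V_i}_j}$;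 $S=(S_1,\dots,S_K)$. Given all of these variables, $W\sim P_{W|S}$. Risks. $L_{\mathcal{D}}(w)=\mathbb{E}_{\mu\sim\mathcal{D}}\mathbb{E}_{Z\sim\mu}\ell(w,Z)$; $L_S(w)=\frac{1}{Kn}\sum_{i=1}^K\sum_{j=1}^n\ell(w,Z_{i,j})$. Generalization error $\mathcal{E}_{\mathcal{D}}(\mathcal{A})=\mathbb{E}[L_{\mathcal{D}}(W)]-\mathbb{E}[L_S(W)]$. Information measures. $I(X;Y)$ is mutual information; the disintegrated mutual information is $I^{z}(X;Y)=\mathrm{D_{KL}}(P_{X,Y|Z=z}\,\|\,P_{X|Z=z}\otimes P_{Y|Z=z})$. *)

(* Defs.v *)
From HB Require Import structures.
From mathcomp Require Import all_boot all_order all_algebra.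
From mathcomp Require Import all_classical all_reals all_analysis.

Set Implicit Arguments.
Unset Strict Implicit.
Unset Printing Implicit Defensive.
Import Order.TTheory GRing.Theory Num.Theory.
Import numFieldNormedType.Exports.

Local Open Scope classical_set_scope.
Local Open Scope ring_scope.

Section infotheory.
Local Open Scope ereal_scope.
Context {R : realType}.

Definition elog (x : \bar R) : \bar R :=
  match x with
  | r%:E => if (0 < r)%R then (ln r)%:E else -oo
  | +oo => +oo
  | -oo => -oo
  end.

Definition esqrt (x : \bar R) : \bar R :=
  match x with
  | r%:E => (Num.sqrt r)%:E
  | +oo => +oo
  | -oo => 0
  end.

Definition KL d (T : measurableType d) (P Q : probability T R) : \bar R :=
  if pselect (charge_of_finite_measure P `<< Q) then
    \int[P]_x elog (Radon_Nikodym (charge_of_finite_measure P) Q x)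
  else +oo.

(* mutual information I(X;Y) = D(P_{X,Y} || P_X (x) P_Y) under the probability
   P; (measurability of X and Y is required for the laws to be defined; the
   value +oo is returned otherwise) *)
Definition mutual_info dO (O : measurableType dO) (P : probability O R)
  d1 (T1 : measurableType d1) d2 (T2 : measurableType d2)
  (X : O -> T1) (Y : O -> T2) : \bar R :=
  match pselect (measurable_fun setT X), pselect (measurable_fun setT Y) with
  | left mX, left mY =>
      KL (distribution P (mfun_Sub (mem_set (measurable_fun_pair mX mY))))
         (distribution P (mfun_Sub (mem_set mX)) \x
          distribution P (mfun_Sub (mem_set mY)))
  | _, _ => +oo
  end.

Definition condP dO (O : measurableType dO) (P : probability O R) (E : set O)
  : probability O R :=
  match pselect (measurable E) with
  | left mE => mnormalize (mrestr P mE) P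
  | right _ => P
  end.

Definition dmutual_info dO (O : measurableType dO) (P : probability O R)
  d1 (T1 : measurableType d1) d2 (T2 : measurableType d2)
  (G : O -> bool) (z : bool) (X : O -> T1) (Y : O -> T2) : \bar R :=
  mutual_info (condP P [set o | G o = z]) X Y.

End infotheory.

Section fl_setting.
Local Open Scope ereal_scope.
Context {R : realType} {dO : measure_display} {O : measurableType dO}.

Definition gen_sigma (G : set (set O)) : set (set O) := <<s G >>.

Definition super_events dC (C : measurableType dC) dZ (Z : measurableType dZ)
  (K n : nat) (mut : 'I_K -> bool -> O -> C)
  (Zt : 'I_K -> bool -> 'I_n -> bool -> O -> Z)
  (V : 'I_K -> O -> bool) (U : 'I_K -> bool -> 'I_n -> O -> bool)
  : set (set O) :=
  [set E | (exists i b (A : set C), measurable A /\ E = mut i b @^-1` A)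
        \/ (exists i b j c (B : set Z), measurable B /\ E = Zt i b j c @^-1` B)
        \/ (exists i (A : set bool), E = V i @^-1` A)
        \/ (exists i b j (A : set bool), E = U i b j @^-1` A)].

End fl_setting.

(* Main.v *)
(** Write the expected generalization gap as a participation gap plus an
    out-of-sample gap, through the mean loss on the unused points ("ghosts") of
    the supersample. The unused point of the non-participating client of a
    superclient is independent of [W], so its mean loss is the population risk;
    the unused points of a participating client are exchangeable given the
    training set, so their mean losses agree. Hence the two gaps are averages of
    [E ((-1)^V X)] for a difference [X] of two losses and a fair bit [V]
    ([V_i], resp. [U_j] given [V_i]).

    Under the product law this mean vanishes, so it is controlled by the
    divergence of the joint law from the product law: for [|g| <= 1] with
    [E_Q g = 0] and [m = E_P g], the Donsker-Varadhan inequality at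
    [s = m g - m^2/2] and [E_Q (exp (m g)) <= cosh m <= exp (m^2/2)] give
    [KL P Q >= E_P s = m^2/2]. *)
Require Import Defs.
From HB Require Import structures.
From mathcomp Require Import all_boot all_order all_algebra.
From mathcomp Require Import all_classical all_reals all_analysis.
From mathcomp Require Import measurable_realfun ring lra.
Import Order.TTheory GRing.Theory Num.Theory.
Import numFieldNormedType.Exports.
Local Open Scope classical_set_scope.
Local Open Scope ring_scope.

(** * Bounding a mean by a divergence *)

(** The right side minus the left vanishes at [0] and has derivative [x (exp x - exp (- x)) >= 0]
    for [x >= 0]. *)
Lemma sinh_le_cosh (R : realType) (c : R) : 0 <= c ->
  expR c - expR (- c) <= c * (expR c + expR (- c)).
Proof.
move=> c0; pose f (x : R) := x * (expR x + expR (- x)) - (expR x - expR (- x)).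
have df (x : R) : is_derive (x : R^o) (1 : R^o) (f : R^o -> R^o)
    (x * (expR x - expR (- x))).
  rewrite /f; apply: is_derive_eq; rewrite /GRing.scale/=; ring.
have cf : {within `[0, c], continuous f}.
  by apply: derivable_within_continuous => x _; exact: ex_derive.
have [d] : exists2 d, d \in `[0, c]%R &
    f c - f 0 = d * (expR d - expR (- d)) * (c - 0).
  exact: (@MVT_segment _ (f : R^o -> R^o) _ 0 c c0 (fun x _ => df x) cf).
rewrite in_itv/= => /andP[d0 _]; rewrite /f mul0r oppr0 subrr !subr0 => fE.
rewrite -subr_ge0 fE; apply: mulr_ge0; last lra.
by apply: mulr_ge0 => //; rewrite subr_ge0 ler_expR; lra.
Qed.

(** By evenness take [t >= 0]. There [exp (- t^2/2) (exp t + exp (- t))] decreases from its value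
    [2] at [0], its derivative having the sign of [sinh t - t cosh t]. *)
Lemma cosh_le_expR_sqr (R : realType) (t : R) :
  (expR t + expR (- t)) / 2 <= expR (t ^+ 2 / 2).
Proof.
wlog t0 : t / 0 <= t.
  move=> H; have [/H//|t0] := leP 0 t.
  by have := H (- t); rewrite opprK sqrrN addrC; apply; lra.
pose f (x : R) := expR (- (x ^+ 2 / 2)) * (expR x + expR (- x)).
pose g (x : R) := expR (- (x ^+ 2 / 2)) *
  (expR x - expR (- x) - x * (expR x + expR (- x))).
have df (x : R) : is_derive (x : R^o) (1 : R^o) (f : R^o -> R^o) (g x).
  rewrite /f /g; apply: is_derive_eq; rewrite /GRing.scale/=.
  by field.
have cf : {within `[0, t], continuous f}.
  by apply: derivable_within_continuous => x _; exact: ex_derive.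
have [d] : exists2 d, d \in `[0, t]%R & f t - f 0 = g d * (t - 0).
  exact: (@MVT_segment _ (f : R^o -> R^o) _ 0 t t0 (fun x _ => df x) cf).
rewrite in_itv/= => /andP[d0 _].
rewrite {1 2}/f expr0n/= mul0r oppr0 expR0 mul1r addr0 => fE.
have : g d * t <= 0.
  by apply: mulr_le0_ge0 => //; rewrite /g mulr_ge0_le0 ?expR_ge0// subr_le0 sinh_le_cosh.
rewrite -fE => H; rewrite ler_pdivrMr//.
rewrite -(ler_pM2l (expR_gt0 (- (t ^+ 2 / 2)))) mulrA -expRD addNr expR0; lra.
Qed.

Section kl_bounds.
Local Open Scope ereal_scope.
Context {d} {T : measurableType d} {R : realType}.

(* unlike [le_integral], [f] may fail to be integrable *)
Lemma le_integral_integrable (m : {measure set T -> \bar R}) (h f : T -> \bar R) :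
  m.-integrable setT h -> measurable_fun setT f ->
  {ae m, forall x, h x <= f x} -> \int[m]_x h x <= \int[m]_x f x.
Proof.
move=> ih mf hf; have mh := measurable_int _ ih.
rewrite integralE [leRHS]integralE; apply: leeB.
- apply: ae_ge0_le_integral => //; [exact: measurable_funepos..|].
  by apply: filterS hf => x hf _; rewrite !funeposE le_max2.
- apply: ae_ge0_le_integral => //; [exact: measurable_funeneg..|].
  by apply: filterS hf => x hf _; rewrite !funenegE le_max2// leeN2.
Qed.

Lemma measurable_elog : measurable_fun [set: \bar R] (@elog R).
Proof.
have -> : @elog R = fun x => if x == +oo then +oo else
    if 0 < x then (ln (fine x))%:E else -oo.
  by apply/funext => -[r| |].
apply: measurable_fun_ifT => //.
  by apply: (measurable_fun_bool true); rewrite setTI;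
    rewrite (_ : _ @^-1` _ = [set +oo])//; apply/seteqP; split => x /=/eqP.
apply: measurable_fun_ifT => //.
  apply: (measurable_fun_bool true); rewrite setTI.
  rewrite (_ : _ @^-1` _ = `]0, +oo]%classic); first exact: emeasurable_itv.
  by apply/seteqP; split => x /=; rewrite in_itv/= leey andbT.
apply/measurable_EFinP/measurableT_comp; first exact: measurable_ln.
exact: fine_measurable.
Qed.

Lemma bounded_integrable (P : probability T R) (g : T -> R) (M : R) :
  measurable_fun setT g -> (forall x, `|g x| <= M)%R ->
  P.-integrable setT (EFin \o g).
Proof.
move=> mg gM; apply: measurable_bounded_integrable => //.
  by rewrite ltey_eq fin_num_measure.
by exists M; split; [exact: num_real|move=> N MN x _ /=; exact: le_trans (ltW MN)].
Qed.

Lemma probability_integral_cst (P : probability T R) (c : R) :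
  \int[P]_x c%:E = c%:E.
Proof. by rewrite integral_cst//= [X in _ * X](probability_setT P) mule1. Qed.

Implicit Types P Q : probability T R.

(** A form of the Donsker-Varadhan inequality. With [F = dP/dQ], integrate
    [ln F >= s + 1 - exp s / F] under [P]; the [P]-mean of [exp s / F] is at most the [Q]-mean of
    [exp s], hence at most [1]. *)
Lemma le_KL P Q (s : T -> R) (M : R) :
  measurable_fun setT s -> (forall x, `|s x| <= M)%R ->
  \int[Q]_x (expR (s x))%:E <= 1 -> \int[P]_x (s x)%:E <= KL P Q.
Proof.
move=> ms sM es1; rewrite /KL; case: pselect => [PQ|nPQ]; last exact: leey.
(* This version of the density is finite and nonnegative at every point; [Radon_Nikodym] is compared
   with it only almost everywhere. *)
pose F := Radon_Nikodym_SigmaFinite.f P Q.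
have Ffin := Radon_Nikodym_SigmaFinite.f_fin_num PQ.
have F0 := Radon_Nikodym_SigmaFinite.f_ge0 PQ.
have mF : measurable_fun setT F.
  by have /measurable_int := Radon_Nikodym_SigmaFinite.f_integrable PQ.
have RNF : ae_eq P setT (Radon_Nikodym (charge_of_finite_measure P) Q) F.
  apply: (null_dominates_ae_eq measurableT PQ); apply: ae_eq_sym.
  exact: ae_eq_Radon_Nikodym_SigmaFinite.
have mpos : measurable (F @^-1` [set 0]).
  by rewrite -[X in measurable X]setTI; exact: mF.
(* The [P]-mass of the zero set of [F] is the [Q]-integral of [F] over that set. *)
have Fpos : {ae P, forall x, 0 < F x}.
  exists (F @^-1` [set 0]); split => //.
    rewrite (Radon_Nikodym_SigmaFinite.f_integral PQ)//.
    by rewrite integral0_eq.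
  by move=> x /= /negP; rewrite -leNgt => Fx; apply/le_anti; rewrite Fx F0.
pose phi x := expR (s x - ln (fine (F x))).
have phi0 x : (0 <= phi x)%R by exact: expR_ge0.
have mfF : measurable_fun setT (fine \o F).
  exact: measurableT_comp (fine_measurable measurableT) mF.
have mphi : measurable_fun setT phi.
  apply: (measurableT_comp (@measurable_expR R)).
  by apply: measurable_funB => //; exact: measurableT_comp (@measurable_ln R) mfF.
have phi1 : \int[P]_x (phi x)%:E <= 1.
  rewrite -(Radon_Nikodym_SigmaFinite.change_of_variables PQ)//;
    [|exact/measurable_EFinP].
  apply: le_trans es1; apply: ge0_le_integral => //.
  - by move=> x _; rewrite mule_ge0 ?lee_fin ?F0.
  - by apply: emeasurable_funM => //; exact/measurable_EFinP.
  - exact/measurable_EFinP/measurableT_comp.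
  - move=> x _; rewrite -(fineK (Ffin x)) -EFinM lee_fin /phi.
    (* Where [F] vanishes the left side is [0] whatever [phi] is; elsewhere it equals [exp s]. *)
    have [->|F0'] := eqVneq (fine (F x)) 0%R; first by rewrite mulr0 expR_ge0.
    have Fx : (0 < fine (F x))%R by rewrite lt_neqAle eq_sym F0' fine_ge0 ?F0.
    by rewrite expRD expRN lnK ?posrE// divfK.
have iphi : P.-integrable setT (EFin \o phi).
  apply/integrableP; split; first exact/measurable_EFinP.
  apply: le_lt_trans (ltry 1); under eq_integral do rewrite gee0_abs ?lee_fin//.
  exact: phi1.
have is' := bounded_integrable P s M ms sM.
have i1 : P.-integrable setT (EFin \o cst 1%R).
  exact: finite_measure_integrable_cst.
rewrite /= [leRHS](ae_eq_integral (elog \o F)) => //; last 3 first.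
- apply: (measurableT_comp measurable_elog).
  by apply: measurable_int; exact: Radon_Nikodym_integrable.
- exact: (measurableT_comp measurable_elog).
- by apply: filterS RNF => x /= /[apply] ->.
(* The mean of [1 - phi] is nonnegative, so adding it can only raise the mean of [s]. *)
apply: (@le_trans _ _ (\int[P]_x ((s x)%:E + (1 - (phi x)%:E)))).
  rewrite integralD//; last exact: integrableB.
  rewrite integralB// probability_integral_cst.
  by rewrite leeDl// sube_ge0// integrable_fin_num.
apply: le_integral_integrable.
- by apply: integrableD => //; exact: integrableB.
- exact: (measurableT_comp measurable_elog).
apply: filterS Fpos => x; rewrite /phi/=; move: (Ffin x); rewrite -/F.
case: (F x) => [r| |]//= _; rewrite lte_fin => r0; rewrite r0 -!EFinD lee_fin.
(* Young's inequality [ln r >= s + 1 - exp s / r] *)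
have := expR_ge1Dx (s x - ln r); rewrite expRD expRN lnK ?posrE//; lra.
Qed.

Lemma mean_le_KL P Q (g : T -> R) :
  measurable_fun setT g -> (forall x, `|g x| <= 1)%R ->
  \int[Q]_x (g x)%:E = 0 ->
  `|\int[P]_x (g x)%:E| <= esqrt (2%:E * KL P Q).
Proof.
move=> mg g1 g0; have ig (P' : probability T R) := bounded_integrable P' g 1 mg g1.
have iP := ig P; have iQ := ig Q.
have [m mE] : exists m, \int[P]_x (g x)%:E = m%:E.
  exists (fine (\int[P]_x (g x)%:E)); rewrite fineK//.
  by apply: integrable_fin_num => //; exact: ig.
(* The multiplier [l = m] maximises [l m - l^2/2], with value [m^2/2]. *)
pose s x := (m * g x - m ^+ 2 / 2)%R.
have ms : measurable_fun setT s by apply: measurable_funB => //; exact: measurable_funM.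
have sM x : (`|s x| <= `|m| + `|m ^+ 2 / 2|)%R.
  by rewrite (le_trans (ler_normB _ _))// lerD2r normrM ler_piMr// g1.
have es1 : \int[Q]_x (expR (s x))%:E <= 1.
  (* [a + b y] is the chord of [exp] over [[-m, m]], taken at [m y]. Since [g] has [Q]-mean [0],
     only [a = cosh m] survives integration. *)
  pose a := ((expR m + expR (- m)) / 2)%R.
  pose b := ((expR m - expR (- m)) / 2)%R.
  pose k := expR (- (m ^+ 2 / 2)).
  apply: (@le_trans _ _ (\int[Q]_x ((k * a)%:E + (k * b)%:E * (g x)%:E))).
    apply: ge0_le_integral => //.
    - exact/measurable_EFinP/measurableT_comp.
    - by apply: emeasurable_funD => //; apply: emeasurable_funM => //;
        exact/measurable_EFinP.
    - move=> x _; rewrite -EFinM -EFinD lee_fin /s expRD -/k mulrC.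
      rewrite -mulrA -mulrDr ler_pM2l ?expR_gt0//.
      (* [exp (m g)] lies below the chord of [exp] over [[-m, m]] *)
      have eA : (expR (m * g x) * (1 + (m - m * g x)) <= expR m)%R.
        rewrite [leRHS](_ : _ = expR (m * g x) * expR (m - m * g x))%R;
          last by rewrite -expRD; congr expR; ring.
        by rewrite ler_pM2l ?expR_gt0// expR_ge1Dx.
      have eB : (expR (m * g x) * (1 + (- m - m * g x)) <= expR (- m))%R.
        rewrite [leRHS](_ : _ = expR (m * g x) * expR (- m - m * g x))%R;
          last by rewrite -expRD; congr expR; ring.
        by rewrite ler_pM2l ?expR_gt0// expR_ge1Dx.
      have := g1 x; rewrite ler_norml => /andP[gl gu].
      (* With the weights [1 + g] and [1 - g] the first-order terms of the two tangent bounds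
         cancel. *)
      have A0 : (0 <= 1 + g x)%R by lra.
      have B0 : (0 <= 1 - g x)%R by lra.
      have := lerD (ler_wpM2l A0 eA) (ler_wpM2l B0 eB).
      by rewrite /a /b; move: (expR (m * g x)) (expR m) (expR (- m)) => ? ? ?; lra.
  rewrite integralD//; last 2 first.
  - exact: finite_measure_integrable_cst.
  - exact: (integrableZl measurableT).
  rewrite integralZl// g0 mule0 adde0 probability_integral_cst.
  rewrite lee_fin /k expRN mulrC ler_pdivrMr ?expR_gt0// mul1r.
  exact: cosh_le_expR_sqr.
have := le_KL P Q s _ ms sM es1.
have -> : \int[P]_x (s x)%:E = (m ^+ 2 / 2)%:E.
  rewrite /s; under eq_integral do rewrite EFinB EFinM.
  rewrite integralB//; last 2 first.
  - exact: (integrableZl measurableT).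
  - exact: finite_measure_integrable_cst.
  rewrite integralZl// mE probability_integral_cst.
  by rewrite -EFinM -EFinB; congr EFin; field.
(* An infinite divergence makes the right side [+oo]; the value [-oo] contradicts the lower bound
   just obtained. *)
rewrite mE; case: (KL P Q) => [r| |]; last by rewrite leeNy_eq.
  rewrite lee_fin -EFinM/= lee_fin => H; rewrite -sqrtr_sqr.
  by apply: ler_wsqrtr; lra.
by move=> _; rewrite gt0_muley/= ?leey// lte_fin; lra.
Qed.

End kl_bounds.

(** * Fair bits and mutual information *)

Definition sign_of {R : realType} (b : bool) : R := if b then -1 else 1.

Section mutual_information_bounds.
Local Open Scope ereal_scope.
Context {d} {O : measurableType d} {R : realType} (P : probability O R).

Lemma measurable_fun_discrete_bool d' (T : measurableType d') (f : bool -> T) :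
  measurable_fun setT f.
Proof. by []. Qed.

Lemma measurable_preimage_bool (V : O -> bool) (B : set bool) :
  measurable_fun setT V -> measurable (V @^-1` B).
Proof. by move=> mV; rewrite -[X in measurable X]setTI; exact: mV. Qed.

Lemma normr_sign_of (b : bool) : (`|@sign_of R b| = 1)%R.
Proof. by case: b; rewrite /sign_of ?normrN1 ?normr1. Qed.

Lemma integral_bool_split (V : O -> bool) (f : O -> \bar R) :
  measurable_fun setT V -> measurable_fun setT f ->
  \int[P]_o f o = \int[P]_(o in V @^-1` [set true]) f o
                + \int[P]_(o in V @^-1` [set false]) f o.
Proof.
move=> mV mf.
rewrite -[in LHS](_ : V @^-1` [set true] `|` V @^-1` [set false] = setT); last first.
  by apply/seteqP; split => // o _ /=; case: (V o); [left|right].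
rewrite integral_setU//; [exact: measurable_preimage_bool..|exact: measurable_funTS|].
by apply/disj_set2P/seteqP; split => // o [/= ->].
Qed.

Lemma integral_sign_of (V : O -> bool) : measurable_fun setT V ->
  P (V @^-1` [set true]) = P (V @^-1` [set false]) ->
  \int[P]_o (@sign_of R (V o))%:E = 0.
Proof.
move=> mV Vunif; have mVb b := measurable_preimage_bool V [set b] mV.
rewrite (integral_bool_split V)//; last exact/measurable_EFinP/measurableT_comp.
rewrite (eq_integral (cst (-1)%:E)); last by move=> o; rewrite inE/= => ->.
rewrite [X in _ + X](eq_integral (cst 1%:E)); last by move=> o; rewrite inE/= => ->.
rewrite !integral_cst//; move: Vunif => /= ->.
by rewrite EFinN mulN1e mul1e addeC subee// fin_num_measure.
Qed.

(* [X] is bounded only on its range; clipping makes the test function bounded on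
   the whole of [R], as needed under the product law *)
Definition clip1 (x : R) : R := Num.max (-1)%R (Num.min 1%R x).

Lemma clip1_id (x : R) : (`|x| <= 1)%R -> clip1 x = x.
Proof.
by rewrite ler_norml => /andP[x1 x2]; rewrite /clip1 (min_idPr _)//; exact/max_idPr.
Qed.

Lemma normr_clip1 (x : R) : (`|clip1 x| <= 1)%R.
Proof.
rewrite ler_norml /clip1 le_max lexx/= ge_max ge_min lexx/= andbT; lra.
Qed.

Lemma measurable_clip1 : measurable_fun setT clip1.
Proof. by apply: measurable_maxr => //; exact: measurable_minr. Qed.

(** The test function [(-1)^v clip1 x] has mean [E ((-1)^V X)] under the joint law. Under the
    product law its mean has the factor [E ((-1)^V)], which is zero for a fair bit. *)
Lemma mean_sign_le_mutual_info (X : O -> R) (V : O -> bool) :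
  measurable_fun setT X -> measurable_fun setT V -> (forall o, `|X o| <= 1)%R ->
  P (V @^-1` [set true]) = P (V @^-1` [set false]) ->
  `|\int[P]_o (sign_of (V o) * X o)%:E| <= esqrt (2%:E * mutual_info P X V).
Proof.
move=> mX mV X1 Vunif; rewrite /mutual_info.
case: pselect => [mX'|//]; case: pselect => [mV'|//].
set PXV := distribution P (mfun_Sub (mem_set (measurable_fun_pair mX' mV'))).
set PX := distribution P (mfun_Sub (mem_set mX')).
set PV := distribution P (mfun_Sub (mem_set mV')).
pose g (p : R * bool) : R := (sign_of p.2 * clip1 p.1)%R.
have mg : measurable_fun setT g.
  apply: measurable_funM.
    exact: (measurableT_comp (@measurable_fun_discrete_bool _ _ (@sign_of R))).
  exact: measurableT_comp measurable_clip1 measurable_fst.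
have g1 p : (`|g p| <= 1)%R by rewrite normrM normr_sign_of mul1r normr_clip1.
have -> : \int[P]_o (sign_of (V o) * X o)%:E = \int[PXV]_p (g p)%:E.
  rewrite integral_distribution/=.
  - by apply: eq_integral => o _; rewrite /g/= clip1_id.
  - exact/measurable_EFinP.
  - have H := bounded_integrable P (fun o => g (X o, V o)) 1
      (measurableT_comp mg (measurable_fun_pair mX' mV')) (fun=> g1 _).
    exact: H.
apply: mean_le_KL => //.
rewrite -integral21_prod_meas1/=; last exact: (bounded_integrable _ _ 1 mg g1).
have [c cE] : exists c, \int[PX]_x (clip1 x)%:E = c%:E.
  exists (fine (\int[PX]_x (clip1 x)%:E)); rewrite fineK//.
  apply: integrable_fin_num => //.
  exact: (bounded_integrable PX _ 1 measurable_clip1 normr_clip1).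
under eq_integral => v _.
  rewrite /fubini_G/g/=; under eq_integral do rewrite EFinM.
  rewrite integralZl//; last first.
    exact: (bounded_integrable PX _ 1 measurable_clip1 normr_clip1).
  rewrite cE muleC; over.
rewrite integralZl//; last first.
  by apply: (bounded_integrable PV sign_of 1) => // v; rewrite normr_sign_of.
rewrite integral_distribution//=; last first.
  apply: (bounded_integrable P (fun o => sign_of (V o)) 1) => [|o];
    last by rewrite /= normr_sign_of.
  exact: measurableT_comp.
by rewrite integral_sign_of// mule0.
Qed.

End mutual_information_bounds.

Section conditional_mutual_information_bounds.
Local Open Scope ereal_scope.
Context {d} {O : measurableType d} {R : realType} (P : probability O R).

(** [condP P E] is [p^-1 P] on subsets of [E] and vanishes off [E]; [p > 0] excludes the default
    value of [mnormalize]. *)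
Lemma ge0_integral_condP (E : set O) (p : R) (f : O -> \bar R) :
  measurable E -> P E = p%:E -> (0 < p)%R ->
  measurable_fun setT f -> (forall o, 0 <= f o) ->
  \int[condP P E]_o f o = (p^-1)%:E * \int[P]_(o in E) f o.
Proof.
move=> mE PE p0 mf f0.
have pV0 : (0 <= p^-1)%R by rewrite invr_ge0 ltW.
have condE A : measurable A -> condP P E A = (p^-1)%:E * P (A `&` E).
  move=> mA; rewrite /condP; case: pselect => // mE'.
  rewrite /= /mnormalize /= /mrestr setTI PE eqe (gt_eqF p0)/= muleC.
  by [].
rewrite (ge0_negligible_integral (N := ~` E))//; last 2 first.
- exact: measurableC.
- apply: etrans (condE _ (measurableC mE)) _.
  by rewrite setICl measure0 mule0.
rewrite setTD setCK (eq_measure_integral (mscale (NngNum pV0) P)); last first.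
  by move=> A mA AE; apply: etrans (condE _ mA) _; rewrite setIidl.
by rewrite ge0_integral_mscale//; exact: measurable_funTS.
Qed.

Lemma integral_condP (E : set O) (p : R) (g : O -> R) (M : R) :
  measurable E -> P E = p%:E -> (0 < p)%R ->
  measurable_fun setT g -> (forall o, `|g o| <= M)%R ->
  \int[P]_(o in E) (g o)%:E = p%:E * \int[condP P E]_o (g o)%:E.
Proof.
move=> mE PE p0 mg gM; have mEg : measurable_fun setT (EFin \o g) by exact/measurable_EFinP.
have iE : P.-integrable E (EFin \o g).
  by apply: integrableS (bounded_integrable P g M mg gM).
rewrite [in RHS]integralE !(ge0_integral_condP _ p)//; last 2 first.
- exact: measurable_funeneg.
- exact: measurable_funepos.
rewrite -muleBr//; last first.
  by rewrite fin_num_adde_defl// fin_numN; exact: integrable_neg_fin_num iE.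
by rewrite muleA -EFinM divff ?gt_eqF// mul1e -integralE.
Qed.

(** On each event [G = z] the integral is half of a mean under the conditional probability, for
    which [U] is still fair, so the unconditional bound applies. The right-hand integrand is
    constant on that event, whose mass is also one half. *)
Lemma mean_sign_le_dmutual_info (G U : O -> bool) (X : O -> R) :
  measurable_fun setT G -> measurable_fun setT U -> measurable_fun setT X ->
  (forall o, `|X o| <= 1)%R ->
  (forall z, P (G @^-1` [set z]) = (2^-1)%:E) ->
  (forall z, P (G @^-1` [set z] `&` U @^-1` [set true]) =
             P (G @^-1` [set z] `&` U @^-1` [set false])) ->
  `|\int[P]_o (sign_of (U o) * X o)%:E| <=
  \int[P]_o esqrt (2%:E * dmutual_info P G (G o) X U).
Proof.
move=> mG mU mX X1 Gunif Uunif.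
have mGb b := measurable_preimage_bool G [set b] mG.
have mg : measurable_fun setT (fun o => (sign_of (U o) * X o)%R).
  apply: measurable_funM => //.
  exact: (measurableT_comp (@measurable_fun_discrete_bool _ _ (@sign_of R))).
have g1 o : (`|sign_of (U o) * X o| <= 1)%R by rewrite normrM normr_sign_of mul1r.
rewrite (integral_bool_split P G)//; last exact/measurable_EFinP.
rewrite [leRHS](integral_bool_split P G)//; last first.
  exact: (measurableT_comp (@measurable_fun_discrete_bool _ _
    (fun z => esqrt (2%:E * dmutual_info P G z X U)))).
apply: le_trans (lee_abs_add _ _) _.
suff H z : `|\int[P]_(o in G @^-1` [set z]) (sign_of (U o) * X o)%:E| <=
    \int[P]_(o in G @^-1` [set z]) esqrt (2%:E * dmutual_info P G (G o) X U).
  by apply: leeD; exact: H.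
rewrite (integral_condP _ 2^-1 _ 1)// abseM gee0_abs ?lee_fin//.
rewrite [leRHS](eq_integral (cst (esqrt (2%:E * dmutual_info P G z X U)))); last first.
  by move=> o; rewrite inE/= => ->.
rewrite integral_cst// [X in _ <= _ * X](Gunif z) [leRHS]muleC.
rewrite lee_pmul2l ?lte_fin ?invr_gt0//.
apply: mean_sign_le_mutual_info => //.
have condE A : measurable A ->
    condP P (G @^-1` [set z]) A = 2%:E * P (A `&` G @^-1` [set z]).
  move=> mA; have h0 : (0 < 2^-1 :> R)%R by rewrite invr_gt0.
  have mA1 : measurable_fun setT (fun o => (\1_A o)%:E : \bar R).
    exact/measurable_EFinP.
  have := ge0_integral_condP _ _ _ (mGb z) (Gunif z) h0 mA1.
  rewrite integral_indic// integral_indic// setIT invrK; apply.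
  by move=> o; rewrite lee_fin.
have mU' b := measurable_preimage_bool U [set b] mU.
apply: etrans (condE _ (mU' _)) _; apply: esym; apply: etrans (condE _ (mU' _)) _.
by rewrite ![_ `&` G @^-1` _]setIC -Uunif.
Qed.

End conditional_mutual_information_bounds.

(** * Uniqueness and mixtures of measures *)

Lemma ge0_integral_mrestr d (T : measurableType d) (R : realType)
    (m : {measure set T -> \bar R}) (E : set T) (mE : measurable E)
    (f : T -> \bar R) :
  measurable_fun setT f -> (forall x, 0 <= f x)%E ->
  (\int[mrestr m mE]_x f x = \int[m]_(x in E) f x)%E.
Proof.
move=> mf f0; rewrite [LHS](ge0_negligible_integral (N := ~` E))//; last 2 first.
- exact: measurableC.
- by rewrite /= /mrestr setICl measure0.
rewrite setTD setCK; apply: eq_measure_integral => A mA AE.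
by rewrite /= /mrestr setIidl.
Qed.

Lemma measurable_forall d (T : measurableType d) (I : finType) (F : I -> set T) :
  (forall i, measurable (F i)) -> measurable [set t | forall i, F i t].
Proof.
move=> mF; rewrite [X in measurable X](_ : _ = \big[setI/setT]_(i in I) F i).
  exact: bigsetI_measurable.
rewrite -bigcap_seq; apply/seteqP; split => t /= H i; first by move=> _; exact: H.
by apply: H; rewrite /= mem_index_enum.
Qed.

(** Rectangles form a pi-system that contains the whole space and generates the sigma-algebra of
    nested tuples. *)
Lemma tuple2_measure_unique d (T : measurableType d) (R : realType) (K n : nat)
    (m1 m2 : {measure set (K.-tuple (n.-tuple T)) -> \bar R}) :
  (m1 setT < +oo)%E ->
  (forall G : 'I_K -> 'I_n -> set T, (forall i j, measurable (G i j)) ->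
     m1 [set t | forall i j, G i j (tnth (tnth t i) j)] =
     m2 [set t | forall i j, G i j (tnth (tnth t i) j)]) ->
  forall A, measurable A -> m1 A = m2 A.
Proof.
move=> m1T m12 A mA.
pose rect : set (set (K.-tuple (n.-tuple T))) :=
  [set B | exists2 G : 'I_K -> 'I_n -> set T, (forall i j, measurable (G i j)) &
    B = [set t | forall i j, G i j (tnth (tnth t i) j)]].
have rectT : rect setT.
  by exists (fun _ _ => setT) => //; apply/seteqP; split.
apply: (g_sigma_algebra_measure_unique rect _ (fun=> setT)) => //.
- move=> _ [G mG ->].
  apply: measurable_forall => i; apply: measurable_forall => j.
  have mij : measurable_fun setT (fun t : K.-tuple (n.-tuple T) => tnth (tnth t i) j).
    exact: (measurableT_comp (measurable_tnth j) (measurable_tnth i)).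
  by rewrite -[X in measurable X]setTI; exact: mij.
- by rewrite bigcup_const.
- move=> _ _ [G mG ->] [G' mG' ->].
  exists (fun i j => G i j `&` G' i j) => [i j|]; first exact: measurableI.
  apply/seteqP; split => t /=.
    by move=> [H H'] i j; split.
  by move=> H; split => i j; have [] := H i j.
- by move=> _ [G mG ->]; exact: m12.
(* A constraint on one coordinate is a rectangle with all other sides full, so every coordinate, and
   thus the identity, is measurable for the sigma-algebra generated by [rect]. *)
- have mid : measurable_fun setT
      (id : g_sigma_algebraType rect -> K.-tuple (n.-tuple T)).
    apply/measurable_fun_tnthP => i; apply/measurable_fun_tnthP => j.
    move=> _ B mB; apply: sub_sigma_algebra; rewrite setTI.
    exists (fun i' j' => if (i' == i) && (j' == j) then B else setT).
      by move=> i' j'; case: ifP.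
    apply/seteqP; split => t /=.
      by move=> H i' j'; case: ifP => // /andP[/eqP -> /eqP ->].
    by move=> /(_ i j); rewrite !eqxx.
  by have := mid measurableT _ mA; rewrite setTI.
Qed.

Lemma prod_measure_unique d1 d2 (T1 : measurableType d1) (T2 : measurableType d2)
    (R : realType) (m1 m2 : {measure set (T1 * T2) -> \bar R}) :
  (m1 setT < +oo)%E ->
  (forall A B, measurable A -> measurable B -> m1 (A `*` B) = m2 (A `*` B)) ->
  forall X, measurable X -> m1 X = m2 X.
Proof.
move=> m1T m12 X mX.
apply: (measure_unique [set A `*` B | A in measurable & B in measurable]
  (fun=> setT)) => //.
- exact: measurable_prod_measurableType.
- move=> _ _ [A mA [B mB <-]] [A' mA' [B' mB' <-]]; rewrite -setXI.
  by exists (A `&` A'); [exact: measurableI|exists (B `&` B') => //; exact: measurableI].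
- by move=> _; exists setT => //; exists setT => //; rewrite setXTT.
- by rewrite bigcup_const.
- by move=> _ [A mA [B mB <-]]; exact: m12.
Qed.

Section mixture.
Local Open Scope ereal_scope.
Context {R : realType} {dC} {C : measurableType dC} {dZ} {Z : measurableType dZ}.
Variables (D : probability C R) (mu : R.-pker C ~> Z).

(** The law of a point drawn from [mu x] with [x] drawn from [D], written as a composition of
    kernels out of [unit] so that integrals against it become iterated integrals. *)
Definition mixture : {measure set Z -> \bar R} :=
  mkcomp (kprobability (@measurable_cst _ _ unit (pprobability C R) setT D))
    (kernel.kernel_snd mu) tt.

Lemma integral_mixture (f : Z -> \bar R) :
  (forall z, 0 <= f z) -> measurable_fun setT f ->
  \int[mixture]_z f z = \int[D]_x \int[mu x]_z f z.
Proof. by move=> f0 mf; rewrite integral_kcomp. Qed.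

End mixture.

(** * The law of the supersample *)

Lemma measure_sum_preimage d (T : measurableType d) (R : realType) (I : finType)
    (m : {measure set T -> \bar R}) (f : T -> I) (E : set T) :
  measurable E -> (forall c, measurable (f @^-1` [set c])) ->
  m E = (\sum_(c : I) m (E `&` f @^-1` [set c]))%E.
Proof.
move=> mE mf.
rewrite -[in LHS](_ : \bigcup_(c in [set` index_enum I]) (E `&` f @^-1` [set c]) = E);
    last first.
  apply/seteqP; split => [t [c _ []//]|t Et].
  by exists (f t) => //=; rewrite mem_index_enum.
rewrite fsbig_seq ?index_enum_uniq// measure_fin_bigcup//.
- by apply/trivIsetP => c1 c2 _ _ /eqP c12; apply/seteqP; split => // t [[_ /= ->] [_ /=]].
- by move=> c _; exact: measurableI.
Qed.

Lemma prodeM_if (R : realType) (I : finType) (p : pred I) (i0 : I) (a : \bar R) :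
  p =1 pred1 i0 -> (\prod_(i : I) (if p i then a else 1) = a)%E.
Proof. by move=> pE; rewrite -big_mkcond (eq_bigl _ _ pE) big_pred1_eq. Qed.

Section supersample.
Context {O Z : Type} {K n : nat} (Zt : 'I_K -> bool -> 'I_n -> bool -> O -> Z)
  (V : 'I_K -> O -> bool) (U : 'I_K -> bool -> 'I_n -> O -> bool).

Definition sample_point (i : 'I_K) (j : 'I_n) (o : O) : Z :=
  Zt i (V i o) j (U i (V i o) j o) o.

(* the unused point of index [j] in the client of the [i]-th superclient that
   participates ([e = false]) or does not participate ([e = true]) *)
Definition ghost_point (e : bool) (i : 'I_K) (j : 'I_n) (o : O) : Z :=
  Zt i (V i o (+) e) j (~~ U i (V i o (+) e) j o) o.

(** All selection bits together, as a finite type over which probabilities can be summed and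
    reindexed. *)
Definition config_type :=
  ({ffun 'I_K -> bool} * {ffun 'I_K * bool * 'I_n -> bool})%type.

Definition config (o : O) : config_type :=
  ([ffun i => V i o], [ffun x => U x.1.1 x.1.2 x.2 o]).

End supersample.
Arguments config_type : clear implicits.

Section supersample_law.
Local Open Scope ereal_scope.
Context {R : realType} {dO} {O : measurableType dO} (P : probability O R)
  {dZ} {Z : measurableType dZ} {dC} {C : measurableType dC}
  (mu : R.-pker C ~> Z) (D : probability C R) {K n : nat}
  (mut : 'I_K -> bool -> O -> C) (Zt : 'I_K -> bool -> 'I_n -> bool -> O -> Z)
  (V : 'I_K -> O -> bool) (U : 'I_K -> bool -> 'I_n -> O -> bool)
  (Zt_meas : forall i b j c, measurable_fun setT (Zt i b j c))
  (V_meas : forall i, measurable_fun setT (V i))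
  (U_meas : forall i b j, measurable_fun setT (U i b j))
  (super_law : forall (Am : 'I_K -> bool -> set C)
      (Bz : 'I_K -> bool -> 'I_n -> bool -> set Z)
      (v : 'I_K -> bool) (u : 'I_K -> bool -> 'I_n -> bool),
      (forall i b, measurable (Am i b)) ->
      (forall i b j c, measurable (Bz i b j c)) ->
      P [set o | (forall i b, Am i b (mut i b o)) /\
                 (forall i b j c, Bz i b j c (Zt i b j c o)) /\
                 (forall i, V i o = v i) /\
                 (forall i b j, U i b j o = u i b j)]
      = (((2%:R ^-1) ^+ (K + 2 * K * n))%:E *
        \prod_(i < K) \prod_(b : bool)
          \int[D]_(x in Am i b) \prod_(j < n) \prod_(c : bool) mu x (Bz i b j c))%E).

Lemma configP (o : O) (c : config_type K n) : config V U o = c <->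
  (forall i, V i o = c.1 i) /\ (forall i b j, U i b j o = c.2 (i, b, j)).
Proof.
split=> [<-|[Vc Uc]]; first by split=> *; rewrite ffunE.
case: c Vc Uc => v u /= Vc Uc; congr (_, _); apply/ffunP.
  by move=> i; rewrite ffunE Vc.
by move=> [[i b] j]; rewrite ffunE /= Uc.
Qed.

Lemma measurable_config (c : config_type K n) : measurable (config V U @^-1` [set c]).
Proof.
rewrite [X in measurable X](_ : _ = [set o | forall i, (V i @^-1` [set c.1 i]) o] `&`
  [set o | forall x, (U x.1.1 x.1.2 x.2 @^-1` [set c.2 x]) o]); last first.
  apply/seteqP; split => o /=.
    by move=> /configP[Vc Uc]; split=> // -[[i b] j].
  by move=> [Vc Uc]; apply/configP; split=> // i b j; exact: (Uc (i, b, j)).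
apply: measurableI; apply: measurable_forall => x;
  rewrite -[X in measurable X]setTI; [exact: V_meas|exact: U_meas].
Qed.

(** The probability that the [2n] points of one client fall in a box. They are independent only
    given the client [x], so the product stays under the integral. *)
Definition client_law (B : 'I_n -> bool -> set Z) : \bar R :=
  \int[D]_x \prod_(j < n) \prod_(c : bool) mu x (B j c).

(** Once all bits are fixed, [E] is a box in the supersample, whose probability [super_law] gives;
    the box may vary with the configuration. *)
Lemma measure_config_rectangles (E : set O)
    (Bz : config_type K n -> 'I_K -> bool -> 'I_n -> bool -> set Z) :
  measurable E -> (forall c i b j k, measurable (Bz c i b j k)) ->
  (forall o, E o <-> forall i b j k, Bz (config V U o) i b j k (Zt i b j k o)) ->
  P E = \sum_(c : config_type K n) (((2%:R ^-1) ^+ (K + 2 * K * n))%:E *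
    \prod_(i < K) \prod_(b : bool) client_law (Bz c i b))%E.
Proof.
move=> mE mB EB; rewrite (measure_sum_preimage _ _ _ _ P (config V U))//;
  last exact: measurable_config.
apply: eq_bigr => c _.
rewrite -(super_law (fun _ _ => setT) (Bz c) c.1 (fun i b j => c.2 (i, b, j)))//.
congr (P _); apply/seteqP; split => o /=.
  by move=> [/EB H oc]; have [Vc Uc] := (configP _ _).1 oc; rewrite -{1}oc.
move=> [_ [H [Vc Uc]]]; have oc : config V U o = c by apply/configP.
by split=> //; apply/EB; rewrite oc.
Qed.

Lemma measurable_choice d' (T : measurableType d') (b : O -> bool) (f : bool -> O -> T) :
  measurable_fun setT b -> (forall c, measurable_fun setT (f c)) ->
  measurable_fun setT (fun o => f (b o) o).
Proof.
move=> mb mf; rewrite [X in measurable_fun _ X](_ : _ =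
    fun o => if b o then f true o else f false o).
  exact: measurable_fun_ifT.
by apply/funext => o; case: (b o).
Qed.

Lemma measurable_sample_point i j : measurable_fun setT (sample_point Zt V U i j).
Proof.
apply: (measurable_choice _ _ (V i) (fun b o => Zt i b j (U i b j o) o)) => // b.
exact: (measurable_choice _ _ (U i b j) (fun c o => Zt i b j c o)).
Qed.

Lemma measurable_ghost_point e i j : measurable_fun setT (ghost_point Zt V U e i j).
Proof.
apply: (measurable_choice _ _ (V i)
  (fun b o => Zt i (b (+) e) j (~~ U i (b (+) e) j o) o)) => // b.
exact: (measurable_choice _ _ (U i (b (+) e) j) (fun c o => Zt i (b (+) e) j (~~ c) o)).
Qed.

Section rectangle.
Variables (G : 'I_K -> 'I_n -> set Z) (mG : forall i j, measurable (G i j)).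

Definition train_box (c : config_type K n) i b j k : set Z :=
  if (b == c.1 i) && (k == c.2 (i, b, j)) then G i j else setT.

(** The ghost coordinate carries the negated bit, so it is never a training coordinate and [S]
    replaces a full side. *)
Definition ghost_box (e : bool) (i0 : 'I_K) (j0 : 'I_n) (S : set Z)
    (c : config_type K n) i b j k : set Z :=
  if [&& i == i0, b == c.1 i (+) e, j == j0 & k == ~~ c.2 (i, b, j)] then S
  else train_box c i b j k.

Definition train_event := [set o | forall i j, G i j (sample_point Zt V U i j o)].

Lemma measurable_train_event : measurable train_event.
Proof.
apply: measurable_forall => i; apply: measurable_forall => j.
by rewrite -[X in measurable X]setTI; exact: measurable_sample_point.
Qed.

Lemma train_boxP o : train_event o <->
  forall i b j k, train_box (config V U o) i b j k (Zt i b j k o).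
Proof.
rewrite /train_box /config/=; split => [H i b j k|H i j].
  by case: ifP => // /andP[/eqP -> /eqP ->]; rewrite !ffunE; exact: H.
by have := H i (V i o) j (U i (V i o) j o); rewrite !ffunE/= !eqxx.
Qed.

Lemma ghost_boxP e i0 j0 S o :
  (train_event `&` ghost_point Zt V U e i0 j0 @^-1` S) o <->
  forall i b j k, ghost_box e i0 j0 S (config V U o) i b j k (Zt i b j k o).
Proof.
split => [[/train_boxP H HS] i b j k|H].
  rewrite /ghost_box /config/=; case: ifP => // /and4P[/eqP -> /eqP -> /eqP -> /eqP ->].
  by rewrite !ffunE; exact: HS.
split.
  apply/train_boxP => i b j k; have := H i b j k; rewrite /ghost_box; case: ifP => //.
  move=> /and4P[_ _ _ /eqP kE] _; rewrite /train_box kE.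
  by case: (c in ~~ c == c); rewrite andbF.
have := H i0 (V i0 o (+) e) j0 (~~ U i0 (V i0 o (+) e) j0 o).
by rewrite /ghost_box /config/= !ffunE !eqxx.
Qed.

Lemma measurable_train_box c i b j k : measurable (train_box c i b j k).
Proof. by rewrite /train_box; case: ifP. Qed.

Lemma measurable_ghost_box e i0 j0 S c i b j k :
  measurable S -> measurable (ghost_box e i0 j0 S c i b j k).
Proof.
by move=> mS; rewrite /ghost_box; case: ifP => // _; exact: measurable_train_box.
Qed.

(** A full side, of mass [1], is replaced by [S]. The new factor appears only in the client that
    holds the ghost and does not depend on [j0]. *)
Lemma prod_ghost_box e i0 j0 S c i b x :
  \prod_(j < n) \prod_(k : bool) mu x (ghost_box e i0 j0 S c i b j k) =
  (\prod_(j < n) \prod_(k : bool) mu x (train_box c i b j k)) *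
  (if (i == i0) && (b == c.1 i (+) e) then mu x S else 1).
Proof.
transitivity (\prod_(j < n) \prod_(k : bool) (mu x (train_box c i b j k) *
    if [&& i == i0, b == c.1 i (+) e, j == j0 & k == ~~ c.2 (i, b, j)]
    then mu x S else 1)).
  apply: eq_bigr => j _; apply: eq_bigr => k _; rewrite /ghost_box.
  case: ifP => [/and4P[_ _ _ /eqP ->]|_]; last by rewrite mule1.
  rewrite /train_box; case: (c.2 _); rewrite andbF prob_kernel mul1e//.
under eq_bigr do rewrite big_split.
rewrite big_split/=; congr (_ * _).
case: (i == i0) => /=; last by rewrite big1// => j _; rewrite big1.
case: (b == _) => /=; last by rewrite big1// => j _; rewrite big1.
rewrite -[RHS](prodeM_if _ _ (pred1 j0) j0 (mu x S))//; apply: eq_bigr => j _ /=.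
case: (j == j0) => /=; last by rewrite big1.
by rewrite (prodeM_if _ _ _ (~~ c.2 (i, b, j))).
Qed.

Lemma train_ghost_law_same (i0 : 'I_K) (j0 j1 : 'I_n) (S : set Z) : measurable S ->
  P (train_event `&` ghost_point Zt V U false i0 j0 @^-1` S) =
  P (train_event `&` ghost_point Zt V U false i0 j1 @^-1` S).
Proof.
move=> mS; have mgS j : measurable (train_event `&` ghost_point Zt V U false i0 j @^-1` S).
  apply: measurableI; first exact: measurable_train_event.
  by rewrite -[X in measurable X]setTI; exact: measurable_ghost_point.
have law j := measure_config_rectangles _ _ (mgS j)
  (fun c i b j' k => measurable_ghost_box false i0 j S c i b j' k mS)
  (ghost_boxP false i0 j S).
rewrite !law; apply: eq_bigr => c _; congr (_ * _).
apply: eq_bigr => i _; apply: eq_bigr => b _; rewrite /client_law.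
by apply: eq_integral => x _; rewrite !prod_ghost_box.
Qed.

(** The client of this ghost does not participate, so no training constraint shares its integral
    over [D], which factors out of the term of every configuration. *)
Lemma train_ghost_law_other (i0 : 'I_K) (j0 : 'I_n) (S : set Z) : measurable S ->
  P (train_event `&` ghost_point Zt V U true i0 j0 @^-1` S) =
  \int[D]_x mu x S * P train_event.
Proof.
move=> mS; have mgS : measurable (train_event `&` ghost_point Zt V U true i0 j0 @^-1` S).
  apply: measurableI; first exact: measurable_train_event.
  by rewrite -[X in measurable X]setTI; exact: measurable_ghost_point.
rewrite (measure_config_rectangles _ _ mgS
  (fun c i b j k => measurable_ghost_box true i0 j0 S c i b j k mS)
  (ghost_boxP true i0 j0 S)).
rewrite (measure_config_rectangles _ _ measurable_train_event
  measurable_train_box train_boxP).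
rewrite ge0_sume_distrr; last first.
  move=> c _; rewrite mule_ge0 ?lee_fin ?exprn_ge0//.
  apply: prode_ge0 => i _; apply: prode_ge0 => b _; apply: integral_ge0 => x _.
  by apply: prode_ge0 => j _; apply: prode_ge0.
apply: eq_bigr => c _; rewrite muleCA; congr (_ * _).
transitivity (\prod_(i < K) \prod_(b : bool) (client_law (train_box c i b) *
    if (i == i0) && (b == c.1 i (+) true) then \int[D]_x mu x S else 1)).
  apply: eq_bigr => i _; apply: eq_bigr => b _; rewrite /client_law.
  under eq_integral do rewrite prod_ghost_box.
  case: ifP => [/andP[_ /eqP bE]|_]; last first.
    by rewrite mule1; apply: eq_integral => x _; rewrite mule1.
  have tT x : \prod_(j < n) \prod_(k : bool) mu x (train_box c i b j k) = 1.
    rewrite big1// => j _; rewrite big1// => k _; rewrite /train_box bE.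
    by case: (c.1 i); rewrite prob_kernel.
  under eq_integral do rewrite tT mul1e.
  under [in RHS]eq_integral do rewrite tT.
  by rewrite probability_integral_cst mul1e.
under eq_bigr do rewrite big_split.
rewrite big_split/= muleC; congr (_ * _).
(* The product of the new factors collapses to the one client [(i0, c.1 i0 (+) true)]. *)
rewrite (bigD1 i0)//= eqxx/= (prodeM_if _ _ _ (c.1 i0 (+) true))// big1 ?mule1//.
by move=> i /negbTE ->; rewrite big1.
Qed.

End rectangle.

End supersample_law.

(** * Symmetry of the selection bits *)

Section uniform_choices.
Local Open Scope ereal_scope.
Context {R : realType} {dO} {O : measurableType dO} (P : probability O R)
  {dZ} {Z : measurableType dZ} {dC} {C : measurableType dC}
  (mu : R.-pker C ~> Z) (D : probability C R) {K n : nat}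
  (mut : 'I_K -> bool -> O -> C) (Zt : 'I_K -> bool -> 'I_n -> bool -> O -> Z)
  (V : 'I_K -> O -> bool) (U : 'I_K -> bool -> 'I_n -> O -> bool)
  (V_meas : forall i, measurable_fun setT (V i))
  (U_meas : forall i b j, measurable_fun setT (U i b j))
  (super_law : forall (Am : 'I_K -> bool -> set C)
      (Bz : 'I_K -> bool -> 'I_n -> bool -> set Z)
      (v : 'I_K -> bool) (u : 'I_K -> bool -> 'I_n -> bool),
      (forall i b, measurable (Am i b)) ->
      (forall i b j c, measurable (Bz i b j c)) ->
      P [set o | (forall i b, Am i b (mut i b o)) /\
                 (forall i b j c, Bz i b j c (Zt i b j c o)) /\
                 (forall i, V i o = v i) /\
                 (forall i b j, U i b j o = u i b j)]
      = (((2%:R ^-1) ^+ (K + 2 * K * n))%:E *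
        \prod_(i < K) \prod_(b : bool)
          \int[D]_(x in Am i b) \prod_(j < n) \prod_(c : bool) mu x (Bz i b j c))%E)
  (i0 : 'I_K) (j0 : 'I_n).

Lemma measurable_config_pred (p : pred (config_type K n)) :
  measurable [set o | p (config V U o)].
Proof.
rewrite [X in measurable X](_ : _ = ~` [set o | forall c,
    (if p c then ~` (config V U @^-1` [set c]) else setT) o]).
  apply/measurableC/measurable_forall => c; case: ifP => // _.
  by apply: measurableC; exact: measurable_config.
apply/seteqP; split => o /= H.
  by move=> /(_ (config V U o)); rewrite H; exact.
by apply: contra_notT H => npo c; case: ifP => // pc /= oc; rewrite oc pc in npo.
Qed.

(** All configurations are equally likely, and an injection of a finite type into itself permutes
    them. *)
Lemma config_symmetry (flip : config_type K n -> config_type K n)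
    (p q : pred (config_type K n)) :
  injective flip -> (forall c, p (flip c) = q c) ->
  P [set o | p (config V U o)] = P [set o | q (config V U o)].
Proof.
move=> flipI pq.
(* the empty box excludes an atom because [i0] and [j0] give a coordinate *)
pose Bz (r : pred (config_type K n)) c (i : 'I_K) (b : bool) (j : 'I_n) (k : bool) :=
  if r c then [set: Z] else set0.
have law (r : pred (config_type K n)) : P [set o | r (config V U o)] =
    \sum_(c : config_type K n) (((2%:R ^-1) ^+ (K + 2 * K * n))%:E *
    \prod_(i < K) \prod_(b : bool) client_law mu D (Bz r c i b))%E.
  apply: (measure_config_rectangles P mu D mut Zt V U V_meas U_meas super_law _ (Bz r)).
  - exact: measurable_config_pred.
  - by move=> *; rewrite /Bz; case: ifP.
  - move=> o; rewrite /Bz/=; case: ifP => // _.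
    by split => // /(_ i0 true j0 true).
rewrite !law (reindex_inj flipI)/=; apply: eq_bigr => c _.
by rewrite /Bz pq.
Qed.

Definition flipV (c : config_type K n) : config_type K n :=
  ([ffun i => (i == i0) (+) c.1 i], c.2).

Lemma flipV_inj : injective flipV.
Proof.
apply: (can_inj (g := flipV)) => -[v u]; congr (_, _).
by apply/ffunP => i; rewrite !ffunE addbA addbb.
Qed.

Definition flipU b (c : config_type K n) : config_type K n :=
  (c.1, [ffun x => (x == (i0, b, j0)) (+) c.2 x]).

Lemma flipU_inj b : injective (flipU b).
Proof.
apply: (can_inj (g := flipU b)) => -[v u]; congr (_, _).
by apply/ffunP => x; rewrite !ffunE addbA addbb.
Qed.

Lemma V_symmetric : P (V i0 @^-1` [set true]) = P (V i0 @^-1` [set false]).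
Proof.
have VE b : V i0 @^-1` [set b] = [set o | (config V U o).1 i0 == b].
  by apply/seteqP; split => o /=; rewrite ffunE => /eqP.
rewrite !VE.
apply: (config_symmetry flipV (fun c : config_type K n => c.1 i0 == true)
  (fun c => c.1 i0 == false)).
  exact: flipV_inj.
by move=> c; rewrite /= ffunE eqxx; case: (c.1 i0).
Qed.

Lemma V_uniform b : P (V i0 @^-1` [set b]) = (2^-1)%:E.
Proof.
suff H : P (V i0 @^-1` [set true]) = (2^-1)%:E by case: b; rewrite -?V_symmetric.
have mVt : measurable (V i0 @^-1` [set true]) by exact: measurable_preimage_bool.
have VC : V i0 @^-1` [set false] = ~` (V i0 @^-1` [set true]).
  by apply/seteqP; split => o /=; case: (V i0 o).
have := V_symmetric; rewrite VC probability_setC//.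
have : P (V i0 @^-1` [set true]) \is a fin_num by rewrite fin_num_measure.
case: (P _) => [r| |]//= _; rewrite -EFinB => -[rE]; congr EFin; lra.
Qed.

(** On [V i0 = z] the random index [V i0 o] is the constant [z], so flipping the single bit
    [(i0, z, j0)] exchanges the two events and leaves [V] untouched. *)
Lemma U_symmetric z :
  P (V i0 @^-1` [set z] `&` (fun o => U i0 (V i0 o) j0 o) @^-1` [set true]) =
  P (V i0 @^-1` [set z] `&` (fun o => U i0 (V i0 o) j0 o) @^-1` [set false]).
Proof.
have UE b : V i0 @^-1` [set z] `&` (fun o => U i0 (V i0 o) j0 o) @^-1` [set b] =
    [set o | ((config V U o).1 i0 == z) && ((config V U o).2 (i0, z, j0) == b)].
  apply/seteqP; split => o /=; rewrite !ffunE/=; first by move=> [-> ->]; rewrite !eqxx.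
  by move=> /andP[/eqP -> /eqP ->].
rewrite !UE; apply: (config_symmetry (flipU z)
  (fun c : config_type K n => (c.1 i0 == z) && (c.2 (i0, z, j0) == true))
  (fun c : config_type K n => (c.1 i0 == z) && (c.2 (i0, z, j0) == false))).
  exact: flipU_inj.
by move=> c; rewrite /= ffunE eqxx; case: (c.2 _).
Qed.

End uniform_choices.

(** * The joint law of the hypothesis and an unused point *)

Section algorithm_law.
Local Open Scope ereal_scope.
Context {R : realType} {dO} {O : measurableType dO} (P : probability O R)
  {dZ} {Z : measurableType dZ} {dC} {C : measurableType dC}
  {dW} {Wsp : measurableType dW}
  (mu : R.-pker C ~> Z) (D : probability C R) {K n : nat}
  (A : R.-pker (K.-tuple (n.-tuple Z)) ~> Wsp)
  (mut : 'I_K -> bool -> O -> C) (Zt : 'I_K -> bool -> 'I_n -> bool -> O -> Z)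
  (V : 'I_K -> O -> bool) (U : 'I_K -> bool -> 'I_n -> O -> bool) (W : O -> Wsp)
  (Zt_meas : forall i b j c, measurable_fun setT (Zt i b j c))
  (V_meas : forall i, measurable_fun setT (V i))
  (U_meas : forall i b j, measurable_fun setT (U i b j))
  (W_meas : measurable_fun setT W)
  (super_law : forall (Am : 'I_K -> bool -> set C)
      (Bz : 'I_K -> bool -> 'I_n -> bool -> set Z)
      (v : 'I_K -> bool) (u : 'I_K -> bool -> 'I_n -> bool),
      (forall i b, measurable (Am i b)) ->
      (forall i b j c, measurable (Bz i b j c)) ->
      P [set o | (forall i b, Am i b (mut i b o)) /\
                 (forall i b j c, Bz i b j c (Zt i b j c o)) /\
                 (forall i, V i o = v i) /\
                 (forall i b j, U i b j o = u i b j)]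
      = (((2%:R ^-1) ^+ (K + 2 * K * n))%:E *
        \prod_(i < K) \prod_(b : bool)
          \int[D]_(x in Am i b) \prod_(j < n) \prod_(c : bool) mu x (Bz i b j c))%E)
  (alg_law : forall (E : set O) (B : set Wsp),
      gen_sigma (super_events mut Zt V U) E -> measurable B ->
      P (E `&` W @^-1` B) =
      (\int[P]_(o in E)
        A [tuple [tuple Zt i (V i o) j (U i (V i o) j o) o | j < n] | i < K] B)%E).

Definition sample (o : O) : K.-tuple (n.-tuple Z) :=
  [tuple [tuple sample_point Zt V U i j o | j < n] | i < K].

Lemma measurable_sample : measurable_fun setT sample.
Proof.
apply/measurable_fun_tnthP => i; apply/measurable_fun_tnthP => j.
rewrite [X in measurable_fun _ X](_ : _ = sample_point Zt V U i j).
  exact: measurable_sample_point.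
by apply/funext => o; rewrite /= !tnth_mktuple.
Qed.

(** [alg_law] applies only to events generated by the superclient variables. On [O'], which is [O]
    with that sigma-algebra, the general measurability lemma for ghosts gives the claim. *)
Lemma super_measurable_ghost e i j (S : set Z) : measurable S ->
  gen_sigma (super_events mut Zt V U) (ghost_point Zt V U e i j @^-1` S).
Proof.
move=> mS; pose O' := g_sigma_algebraType (super_events mut Zt V U).
have mY : measurable_fun setT (ghost_point Zt V U e i j : O' -> Z).
  apply: measurable_ghost_point => *; move=> _ B mB; rewrite setTI;
    apply: sub_sigma_algebra.
  - by right; left; do 4 eexists; exists B.
  - by right; right; left; eexists; exists B.
  - by right; right; right; do 3 eexists; exists B.
by have := mY measurableT S mS; rewrite setTI.
Qed.

Lemma measurable_ghost_preimage e i j (S : set Z) : measurable S ->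
  measurable (ghost_point Zt V U e i j @^-1` S).
Proof.
by move=> mS; rewrite -[X in measurable X]setTI; exact: measurable_ghost_point.
Qed.

Lemma train_eventE (G : 'I_K -> 'I_n -> set Z) :
  sample @^-1` [set t | forall i j, G i j (tnth (tnth t i) j)] = train_event Zt V U G.
Proof.
apply/seteqP; split => o /= H i j; first by have := H i j; rewrite !tnth_mktuple.
by rewrite !tnth_mktuple; exact: H.
Qed.

(** The laws of the training sample restricted to the two ghost events agree on rectangles by
    [train_ghost_law_same], hence everywhere. *)
Lemma ghost_integral_same i j1 j2 (S : set Z) (h : K.-tuple (n.-tuple Z) -> \bar R) :
  measurable S -> measurable_fun setT h -> (forall t, 0 <= h t) ->
  \int[P]_(o in ghost_point Zt V U false i j1 @^-1` S) h (sample o) =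
  \int[P]_(o in ghost_point Zt V U false i j2 @^-1` S) h (sample o).
Proof.
move=> mS mh h0.
pose m' j : {measure set _ -> \bar R} :=
  pushforward (mrestr P (measurable_ghost_preimage false i j S mS)) sample.
pose m := m' measurable_sample.
have mE j : \int[P]_(o in ghost_point Zt V U false i j @^-1` S) h (sample o) =
    \int[m j]_t h t.
  rewrite (ge0_integral_pushforward measurable_sample)//= ?ge0_integral_mrestr//.
  exact: measurableT_comp mh measurable_sample.
rewrite !mE; apply: eq_measure_integral => B mB _.
apply: tuple2_measure_unique B mB => [|G mG].
  rewrite /m /m' /= /pushforward /mrestr preimage_setT setTI.
  by rewrite ltey_eq fin_num_measure//; exact: measurable_ghost_preimage.
rewrite /m /m' /= /pushforward /mrestr.
rewrite (train_eventE G).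
exact: (train_ghost_law_same P mu D mut).
Qed.

(** By [train_ghost_law_other], restricting to the ghost event only rescales the law of the training
    sample: this is the independence of ghost and sample. *)
Lemma ghost_integral_other i j (S : set Z) (h : K.-tuple (n.-tuple Z) -> \bar R) :
  measurable S -> measurable_fun setT h -> (forall t, 0 <= h t) ->
  \int[P]_(o in ghost_point Zt V U true i j @^-1` S) h (sample o) =
  (\int[D]_x mu x S) * \int[P]_o h (sample o).
Proof.
move=> mS mh h0.
pose m' : {measure set _ -> \bar R} :=
  pushforward (mrestr P (measurable_ghost_preimage true i j S mS)) sample.
pose m := m' measurable_sample.
pose m0' : {measure set _ -> \bar R} := pushforward P sample.
pose m0 := m0' measurable_sample.
have mhs : measurable_fun setT (h \o sample).
  exact: measurableT_comp mh measurable_sample.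
(* Finiteness lets this mass serve as a real scaling factor in [mscale]. *)
have p_fin : \int[D]_x mu x S \is a fin_num.
  apply/fin_numP; split; first by rewrite gt_eqF// (lt_le_trans ltNy0)// integral_ge0.
  apply/eqP => H; have : \int[D]_x mu x S <= \int[D]_x 1%:E.
    apply: ge0_le_integral => //; first exact: measurable_kernel.
    move=> x _; have <- : mu x setT = 1 by exact: prob_kernel.
    by apply: le_measure; rewrite ?inE.
  by rewrite H probability_integral_cst leye_eq.
have p0 : (0 <= fine (\int[D]_x mu x S))%R by rewrite fine_ge0// integral_ge0.
rewrite -[in RHS](fineK p_fin) -[X in X * _]/((NngNum p0)%:num%:E).
transitivity (\int[m]_t h t).
  by rewrite (ge0_integral_pushforward measurable_sample)//= ge0_integral_mrestr.
transitivity (\int[mscale (NngNum p0) m0]_t h t); last first.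
  by rewrite ge0_integral_mscale// (ge0_integral_pushforward measurable_sample)//.
apply: eq_measure_integral => B mB _.
apply: tuple2_measure_unique B mB => [|G mG].
  rewrite /m /m' /= /pushforward /mrestr preimage_setT setTI.
  by rewrite ltey_eq fin_num_measure//; exact: measurable_ghost_preimage.
rewrite /m /m' /mscale /m0 /m0' /= /pushforward /mrestr !train_eventE /=.
apply: etrans (train_ghost_law_other P mu D mut Zt V U Zt_meas V_meas U_meas
  super_law G mG i j S mS) _.
rewrite -train_eventE [RHS](_ : _ = (fine (\int[D]_x mu x S))%:E *
  P (sample @^-1` [set t | forall i j, G i j (tnth (tnth t i) j)]))//.
by rewrite fineK.
Qed.

Lemma joint_rectangle e i j (B : set Wsp) (S : set Z) :
  measurable B -> measurable S ->
  P (W @^-1` B `&` ghost_point Zt V U e i j @^-1` S) =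
  \int[P]_(o in ghost_point Zt V U e i j @^-1` S) A (sample o) B.
Proof.
by move=> mB mS; rewrite setIC alg_law//; exact: super_measurable_ghost.
Qed.

Lemma hypothesis_law (B : set Wsp) : measurable B ->
  P (W @^-1` B) = \int[P]_o A (sample o) B.
Proof.
move=> mB; rewrite -[W @^-1` B]setTI alg_law//.
by rewrite -[setT]setC0; apply: sigma_algebraC; exact: sigma_algebra0.
Qed.

Variable f : Wsp * Z -> \bar R.
Hypotheses (mf : measurable_fun setT f) (f0 : forall p, 0 <= f p).

(** On a rectangle the joint law of [W] and a ghost is an integral of [A (sample o) B] over the
    ghost event, so [ghost_integral_same] identifies the two joint laws. *)
Lemma ghost_expectation_same i j1 j2 :
  \int[P]_o f (W o, ghost_point Zt V U false i j1 o) =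
  \int[P]_o f (W o, ghost_point Zt V U false i j2 o).
Proof.
have mWY j : measurable_fun setT (fun o => (W o, ghost_point Zt V U false i j o)).
  by apply: measurable_fun_pair => //; exact: measurable_ghost_point.
pose J' j : {measure set (Wsp * Z) -> \bar R} :=
  pushforward P (fun o => (W o, ghost_point Zt V U false i j o)).
pose J j := J' mWY j.
have JE j : \int[P]_o f (W o, ghost_point Zt V U false i j o) = \int[J j]_p f p.
  by rewrite (ge0_integral_pushforward (mWY j)).
rewrite !JE; apply: eq_measure_integral => X mX _.
apply: prod_measure_unique X mX => [|B S mB mS].
  by rewrite /J /J' /= /pushforward preimage_setT ltey_eq fin_num_measure.
rewrite /J /J' /= /pushforward.
transitivity (\int[P]_(o in ghost_point Zt V U false i j1 @^-1` S) A (sample o) B).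
  exact: joint_rectangle.
rewrite (ghost_integral_same i j1 j2 S (fun t => A t B))//; last exact: measurable_kernel.
by rewrite -joint_rectangle.
Qed.

(** [W] depends on the supersample only through the training sample, so it is independent of this
    ghost. The joint law is a product and Tonelli applies. *)
Lemma ghost_expectation_other i j :
  \int[P]_o f (W o, ghost_point Zt V U true i j o) =
  \int[P]_o \int[D]_x \int[mu x]_z f (W o, z).
Proof.
have mY := measurable_ghost_point Zt V U Zt_meas V_meas U_meas true i j.
have mWY : measurable_fun setT (fun o => (W o, ghost_point Zt V U true i j o)).
  exact: measurable_fun_pair.
pose J' : {measure set (Wsp * Z) -> \bar R} :=
  pushforward P (fun o => (W o, ghost_point Zt V U true i j o)).
pose J := J' mWY.
pose PW := distribution P (mfun_Sub (mem_set W_meas)).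
pose PY := distribution P (mfun_Sub (mem_set mY)).
(* The choice [h = 1] gives the law of the ghost itself, which is the mixture. *)
have PYE S : measurable S -> PY S = \int[D]_x mu x S.
  move=> mS; have := ghost_integral_other i j S (cst 1) mS (measurable_cst _) (fun=> lee01).
  rewrite !probability_integral_cst integral_cst ?mul1e ?mule1//.
  exact: measurable_ghost_preimage.
have -> : \int[P]_o f (W o, ghost_point Zt V U true i j o) = \int[J]_p f p.
  by rewrite (ge0_integral_pushforward mWY).
have -> : \int[J]_p f p = \int[PW \x PY]_p f p.
  apply: eq_measure_integral => X mX _; apply: esym.
  apply: product_measure_unique mX => B S mB mS.
  transitivity (\int[P]_(o in ghost_point Zt V U true i j @^-1` S) A (sample o) B).
    exact: joint_rectangle.
  rewrite (ghost_integral_other i j S (fun t => A t B))//; last exact: measurable_kernel.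
  by rewrite -PYE// -hypothesis_law// muleC.
rewrite fubini_tonelli1// (ge0_integral_pushforward W_meas)//; last 2 first.
- exact: measurable_fun_fubini_tonelli_F.
- by move=> w _; apply: integral_ge0.
apply: eq_integral => o _ /=; rewrite /fubini_F.
rewrite -integral_mixture//; last exact: measurableT_comp mf (measurable_pair1 _).
by apply: eq_measure_integral => S mS _; exact: PYE.
Qed.

End algorithm_law.

(** * The generalization bound *)

Lemma ereal_finite (R : realType) (x : \bar R) : x \is a fin_num -> exists r : R, x = r%:E.
Proof. by move=> xf; exists (fine x); rewrite fineK. Qed.

Theorem mainTheorem14
  (R : realType)
  (dO : measure_display) (O : measurableType dO) (P : probability O R)
  (dZ : measure_display) (Z : measurableType dZ)
  (dW : measure_display) (Wsp : measurableType dW)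
  (dC : measure_display) (C : measurableType dC)
  (mu : R.-pker C ~> Z)
  (D : probability C R)
  (loss : Wsp -> Z -> R)
  (loss_meas : measurable_fun setT (fun p : Wsp * Z => loss p.1 p.2))
  (loss01 : forall w z, 0 <= loss w z <= 1)
  (K n : nat) (K_gt0 : (0 < K)%N) (n_gt0 : (0 < n)%N)
  (A : R.-pker (K.-tuple (n.-tuple Z)) ~> Wsp)
  (mut : 'I_K -> bool -> O -> C)
  (Zt : 'I_K -> bool -> 'I_n -> bool -> O -> Z)
  (V : 'I_K -> O -> bool)
  (U : 'I_K -> bool -> 'I_n -> O -> bool)
  (W : O -> Wsp)
  (mut_meas : forall i b, measurable_fun setT (mut i b))
  (Zt_meas : forall i b j c, measurable_fun setT (Zt i b j c))
  (V_meas : forall i, measurable_fun setT (V i))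
  (U_meas : forall i b j, measurable_fun setT (U i b j))
  (W_meas : measurable_fun setT W)
  (super_law : forall (Am : 'I_K -> bool -> set C)
      (Bz : 'I_K -> bool -> 'I_n -> bool -> set Z)
      (v : 'I_K -> bool) (u : 'I_K -> bool -> 'I_n -> bool),
      (forall i b, measurable (Am i b)) ->
      (forall i b j c, measurable (Bz i b j c)) ->
      P [set o | (forall i b, Am i b (mut i b o)) /\
                 (forall i b j c, Bz i b j c (Zt i b j c o)) /\
                 (forall i, V i o = v i) /\
                 (forall i b j, U i b j o = u i b j)]
      = (((2%:R ^-1) ^+ (K + 2 * K * n))%:E *
        \prod_(i < K) \prod_(b : bool)
          \int[D]_(x in Am i b) \prod_(j < n) \prod_(c : bool) mu x (Bz i b j c))%E)
  (alg_law : forall (E : set O) (B : set Wsp),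
      gen_sigma (super_events mut Zt V U) E -> measurable B ->
      P (E `&` W @^-1` B) =
      (\int[P]_(o in E)
        A [tuple [tuple Zt i (V i o) j (U i (V i o) j o) o | j < n] | i < K] B)%E) :
  let j1 : 'I_n := Ordinal n_gt0 in
  (* training point Z_{i,j} *)
  let Ztrain i j o := Zt i (V i o) j (U i (V i o) j o) o in
  (* population risk L_D(w) and empirical risk L_S(w) *)
  let LD (w : Wsp) := (\int[D]_x \int[mu x]_z (loss w z)%:E)%E in
  let LS (w : Wsp) o :=
    ((K * n)%:R ^-1 * \sum_(i < K) \sum_(j < n) loss w (Ztrain i j o)) in
  let gen_err := (\int[P]_o LD (W o) - \int[P]_o (LS (W o) o)%:E)%E in
  (* Delta \bar L_i = \bar L^-_i - \bar L^+_i *)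
  let dLbar i o := loss (W o) (Zt i true j1 (~~ U i true j1 o) o)
                   - loss (W o) (Zt i false j1 (~~ U i false j1 o) o) in
  (* Delta L^i_j = L^{i-}_j - L^{i+}_j *)
  let dL i j o := loss (W o) (Zt i (V i o) j true o)
                  - loss (W o) (Zt i (V i o) j false o) in
  (* U^{i,V_i}_j *)
  let UV i j o := U i (V i o) j o in
  (`| gen_err | <=
     (K%:R ^-1)%:E * \sum_(i < K) esqrt (2%:E * mutual_info P (dLbar i) (V i))
   + ((K * n)%:R ^-1)%:E * \sum_(i < K) \sum_(j < n)
       \int[P]_o esqrt (2%:E * dmutual_info P (V i) (V i o) (dL i j) (UV i j)))%E.
Proof.
pose j1 : 'I_n := Ordinal n_gt0.
pose Ztrain i j o := Zt i (V i o) j (U i (V i o) j o) o.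
pose LD (w : Wsp) := (\int[D]_x \int[mu x]_z (loss w z)%:E)%E.
pose LS (w : Wsp) o :=
  ((K * n)%:R ^-1 * \sum_(i < K) \sum_(j < n) loss w (Ztrain i j o)).
pose gen_err := (\int[P]_o LD (W o) - \int[P]_o (LS (W o) o)%:E)%E.
pose dLbar i o := loss (W o) (Zt i true j1 (~~ U i true j1 o) o)
                  - loss (W o) (Zt i false j1 (~~ U i false j1 o) o).
pose dL i j o := loss (W o) (Zt i (V i o) j true o)
                 - loss (W o) (Zt i (V i o) j false o).
pose UV i j o := U i (V i o) j o.
change (`| gen_err | <=
     (K%:R ^-1)%:E * \sum_(i < K) esqrt (2%:E * mutual_info P (dLbar i) (V i))
   + ((K * n)%:R ^-1)%:E * \sum_(i < K) \sum_(j < n)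
       \int[P]_o esqrt (2%:E * dmutual_info P (V i) (V i o) (dL i j) (UV i j)))%E.
pose f (p : Wsp * Z) := (loss p.1 p.2)%:E.
have mf : measurable_fun setT f by exact/measurable_EFinP.
have f0 p : (0 <= f p)%E by rewrite lee_fin; case/andP: (loss01 p.1 p.2).
have f_loss (Y : O -> Z) : measurable_fun setT Y ->
    measurable_fun setT (fun o => loss (W o) (Y o)).
  move=> mY; exact: (measurableT_comp loss_meas (measurable_fun_pair W_meas mY)).
have loss1 w z : `|loss w z| <= 1.
  by have /andP[l0 l1] := loss01 w z; rewrite ger0_norm.
have iloss (Y : O -> Z) : measurable_fun setT Y ->
    P.-integrable setT (fun o => (loss (W o) (Y o))%:E).
  move=> mY; exact: (bounded_integrable P _ 1 (f_loss Y mY) (fun=> loss1 _ _)).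
have mT i j : measurable_fun setT (Ztrain i j).
  exact: (measurable_sample_point Zt V U).
have mG e i j : measurable_fun setT (ghost_point Zt V U e i j).
  exact: measurable_ghost_point.
have fin (Y : O -> Z) : measurable_fun setT Y ->
    exists r : R, (\int[P]_o (loss (W o) (Y o))%:E = r%:E)%E.
  move=> mY; apply: ereal_finite; apply: integrable_fin_num => //; exact: iloss.
(* Mean losses as real numbers: [a] on the ghosts of non-participating clients, [g] on the ghosts of
   participating clients, [t] on the training points. *)
have [a aE] := choice (fun i => fin _ (mG true i j1)).
have [g gE] := choice (fun i => fin _ (mG false i j1)).
have [t tE] := choice (fun ij : 'I_K * 'I_n => fin _ (mT ij.1 ij.2)).
have gEj i j : (\int[P]_o (loss (W o) (ghost_point Zt V U false i j o))%:E = (g i)%:E)%E.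
  rewrite -gE; exact: (ghost_expectation_same P mu D A mut Zt V U W Zt_meas V_meas
    U_meas W_meas super_law alg_law f mf f0).
have ELD i : (\int[P]_o LD (W o) = (a i)%:E)%E.
  rewrite -aE; apply: esym; exact: (ghost_expectation_other P mu D A mut Zt V U W
    Zt_meas V_meas U_meas W_meas super_law alg_law f mf f0).
have K0 : K%:R != 0 :> R by rewrite pnatr_eq0 -lt0n.
have n0 : n%:R != 0 :> R by rewrite pnatr_eq0 -lt0n.
have ELS : (\int[P]_o (LS (W o) o)%:E =
    ((K * n)%:R ^-1 * \sum_(i < K) \sum_(j < n) t (i, j))%:E)%E.
  rewrite /LS; under eq_integral => o _.
    rewrite EFinM -sumEFin; under eq_bigr do rewrite -sumEFin; over.
  rewrite integralZl//; last first.
    by apply: integrable_sum => // i _; apply: integrable_sum => // j _; exact: iloss.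
  rewrite EFinM -sumEFin integral_sum//; last first.
    by move=> i; apply: integrable_sum => // j _; exact: iloss.
  congr (_ * _)%E; apply: eq_bigr => i _; rewrite -sumEFin integral_sum//.
    by apply: eq_bigr => j _; rewrite -tE.
  by move=> j; exact: iloss.
pose i0 : 'I_K := Ordinal K_gt0.
(* The participation gap [a - g] plus the out-of-sample gap [g - t]. This uses that all [a i] equal
   the population risk and that [g i] serves for every index [j]. *)
have genE : gen_err = (K%:R^-1 * \sum_(i < K) (a i - g i) +
    (K * n)%:R^-1 * \sum_(i < K) \sum_(j < n) (g i - t (i, j)))%:E.
  rewrite /gen_err (ELD i0) ELS -EFinB; congr EFin.
  have -> : \sum_(i < K) (a i - g i) = a i0 *+ K - \sum_(i < K) g i.
    rewrite sumrB; congr (_ - _); rewrite -[X in _ *+ X]card_ord -sumr_const.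
    by apply: eq_bigr => i _; have := ELD i; rewrite (ELD i0) => -[].
  have -> : \sum_(i < K) \sum_(j < n) (g i - t (i, j)) =
      (\sum_(i < K) g i) *+ n - \sum_(i < K) \sum_(j < n) t (i, j).
    rewrite -sumrMnl -sumrB; apply: eq_bigr => i _.
    by rewrite sumrB sumr_const card_ord.
  rewrite natrM -mulr_natr -[X in _ + _ * (X - _)]mulr_natr.
  by field; apply/andP.
rewrite genE.
have diff1 w z1 z2 : `|loss w z1 - loss w z2| <= 1.
  have /andP[l0 l1] := loss01 w z1; have /andP[l0' l1'] := loss01 w z2.
  by rewrite ler_norml; lra.
have mZU i b : measurable_fun setT (fun o => Zt i b j1 (~~ U i b j1 o) o).
  exact: (measurable_choice _ _ (U i b j1) (fun c o => Zt i b j1 (~~ c) o)).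
have mZV i j c : measurable_fun setT (fun o => Zt i (V i o) j c o).
  exact: (measurable_choice _ _ (V i) (fun b o => Zt i b j c o)).
have mUV i j : measurable_fun setT (UV i j).
  exact: (measurable_choice _ _ (V i) (fun b o => U i b j o)).
(* The sign [(-1)^V] orients [dLbar] as non-participating minus participating client, for either
   value of [V i]. *)
have sgnV i : (`|(a i - g i)%:E| <= esqrt (2%:E * mutual_info P (dLbar i) (V i)))%E.
  have -> : (a i - g i)%:E = (\int[P]_o (sign_of (V i o) * dLbar i o)%:E)%E.
    rewrite EFinB -aE -gE -integralB//; [|exact: iloss..].
    apply: eq_integral => o _; rewrite /dLbar /ghost_point -EFinB; congr EFin.
    by rewrite /sign_of; case: (V i o) => /=; ring.
  apply: mean_sign_le_mutual_info => //.
  - by apply: measurable_funB; exact: f_loss.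
  - by move=> o; exact: diff1.
  - exact: (V_symmetric P mu D mut Zt V U V_meas U_meas super_law i j1).
have sgnU i j : (`|(g i - t (i, j))%:E| <=
    \int[P]_o esqrt (2%:E * dmutual_info P (V i) (V i o) (dL i j) (UV i j)))%E.
  have -> : (g i - t (i, j))%:E = (\int[P]_o (sign_of (UV i j o) * dL i j o)%:E)%E.
    rewrite EFinB -(gEj i j) -tE -integralB//; [|exact: iloss..].
    apply: eq_integral => o _; rewrite /dL /Ztrain /UV /ghost_point addbF -EFinB.
    by congr EFin; rewrite /sign_of; case: (U i _ j o) => /=; ring.
  apply: mean_sign_le_dmutual_info => //.
  - by apply: measurable_funB; exact: f_loss.
  - by move=> o; exact: diff1.
  - exact: (V_uniform P mu D mut Zt V U V_meas U_meas super_law i j1).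
  - exact: (U_symmetric P mu D mut Zt V U V_meas U_meas super_law i j).
rewrite EFinD; apply: le_trans (lee_abs_add _ _) _; apply: leeD.
- rewrite EFinM abseM gee0_abs ?lee_fin ?invr_ge0//; apply: lee_wpmul2l.
    by rewrite lee_fin invr_ge0.
  rewrite -sumEFin; apply: le_trans (lee_abs_sum _ _ _) _.
  by apply: lee_sum => i _; exact: sgnV.
- rewrite EFinM abseM gee0_abs ?lee_fin ?invr_ge0//; apply: lee_wpmul2l.
    by rewrite lee_fin invr_ge0.
  rewrite -sumEFin; apply: le_trans (lee_abs_sum _ _ _) _.
  apply: lee_sum => i _; rewrite -sumEFin; apply: le_trans (lee_abs_sum _ _ _) _.
  by apply: lee_sum => j _; exact: sgnU.
Qed.
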